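(* Suppose $\alpha,\beta,\gamma$ are positive real numbers such that $\alpha,\beta>\gamma$. Then the Kähler metric on $\mathbb{D}^2$ with coefficients $$\mathcal{B}^{(\alpha,\beta,\gamma)}_{i\bar j}(\boldsymbol z)=\frac{\partial^2}{\partial z_i\partial\bar z_j}\log B_{(\alpha,\beta,\gamma)}(\boldsymbol z,\boldsymbol z),\qquad 1\le i,j\le 2,\ \boldsymbol z\in\mathbb{D}^2,$$ i.e. with Kähler form $\sqrt{-1}\sum_{i,j=1}^2\mathcal{B}^{(\alpha,\beta,\gamma)}_{i\bar j}\,dz_i\wedge d\bar z_j$, is not Kähler–Einstein.
   Context: $\mathbb{D}$ is the open unit disc in $\mathbb{C}$ and $$B_{(\alpha,\beta,\gamma)}(\boldsymbol z,\boldsymbol w)=(1-z_1\overline{w}_1)^{-\alpha}(1-z_2\overline{w}_2)^{-\beta}(1-z_1\overline{w}_2)^{\gamma}(1-z_2\overline{w}_1)^{\gamma},\quad \boldsymbol z,\boldsymbol w\in\mathbb{D}^2$$ (principal branches). For an $n$-dimensional Kähler manifold with Kähler form $\omega=\sqrt{-1}\sum_{i,j=1}^n g_{i\bar j}\,dz_i\wedge d\bar z_j$, the Ricci form is $\mathrm{Ric}=-\sqrt{-1}\sum_{i,j=1}^n\partial_i\bar\partial_j\log\det(g_{k\bar l})_{k,l=1}^n\,dz_i\wedge d\bar z_j$. The manifold is Kähler–Einstein if $\mathrm{Ric}$ is a (constant) scalar multiple of $\omega$. *)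

(* Defs.v *)
(* MathComp, with MathComp-Analysis over an arbitrary model R of the real numbers;
   complex numbers are R[i]. *)
From HB Require Import structures.
From mathcomp Require Import all_boot all_order all_algebra.
From mathcomp Require Import complex.
From mathcomp Require Import all_classical all_reals all_analysis.

Set Implicit Arguments.
Unset Strict Implicit.
Unset Printing Implicit Defensive.

Import Order.TTheory GRing.Theory Num.Theory.
Import numFieldNormedType.Exports.

Local Open Scope classical_set_scope.
Local Open Scope ring_scope.
Local Open Scope complex_scope.

Definition cexp (R : realType) (z : R[i]) : R[i] :=
  (expR (complex.Re z))%:C * (cos (complex.Im z) +i* sin (complex.Im z)).

(* Principal argument, in ]-pi, pi]; the value at 0 is irrelevant. *)
Definition carg (R : realType) (z : R[i]) : R :=
  let t := acos (complex.Re z / complex.Re `|z|) in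
  if 0 <= complex.Im z then t else - t.

Definition clog (R : realType) (z : R[i]) : R[i] :=
  ln (complex.Re `|z|) +i* carg z.

Definition cpow (R : realType) (z : R[i]) (a : R) : R[i] :=
  cexp (a%:C * clog z).

(* Derivative at t = 0, for real t, of f (z + t v). *)
Definition real_dderiv (R : realType) (n : nat) (f : 'rV[R[i]]_n -> R[i])
    (z v : 'rV[R[i]]_n) : R[i] :=
  derive1 (fun t : R => complex.Re (f (z + t%:C *: v))) 0
  +i* derive1 (fun t : R => complex.Im (f (z + t%:C *: v))) 0.

(* Wirtinger operators: d/dz_i = (d/dx_i - i d/dy_i) / 2 and
   d/dzbar_i = (d/dx_i + i d/dy_i) / 2, where z_i = x_i + i y_i. *)
Definition dz (R : realType) (n : nat) (i : 'I_n) (f : 'rV[R[i]]_n -> R[i])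
    (z : 'rV[R[i]]_n) : R[i] :=
  (real_dderiv f z (delta_mx 0 i)
   - 'i%C * real_dderiv f z ('i%C *: delta_mx 0 i)) / 2%:R.

Definition dzbar (R : realType) (n : nat) (i : 'I_n) (f : 'rV[R[i]]_n -> R[i])
    (z : 'rV[R[i]]_n) : R[i] :=
  (real_dderiv f z (delta_mx 0 i)
   + 'i%C * real_dderiv f z ('i%C *: delta_mx 0 i)) / 2%:R.

Definition ddbar (R : realType) (n : nat) (f : 'rV[R[i]]_n -> R[i])
    (z : 'rV[R[i]]_n) : 'M[R[i]]_n :=
  \matrix_(i, j) dz i (dzbar j f) z.

(* The (1,1)-form  sqrt(-1) sum_(i,j) h_(i,j) dz_i /\ dzbar_j  evaluated at
   tangent vectors u, v, with the convention
   (dz_i /\ dzbar_j)(u, v) = dz_i(u) dzbar_j(v) - dz_i(v) dzbar_j(u). *)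
Definition form11 (R : realType) (n : nat) (h : 'M[R[i]]_n)
    (u v : 'rV[R[i]]_n) : R[i] :=
  'i%C * \sum_(i < n) \sum_(j < n)
         h i j * (u 0 i * (v 0 j)^*%C - v 0 i * (u 0 j)^*%C).

Definition kahler_form (R : realType) (n : nat)
    (g : 'rV[R[i]]_n -> 'M[R[i]]_n) (z : 'rV[R[i]]_n) :
    'rV[R[i]]_n -> 'rV[R[i]]_n -> R[i] :=
  form11 (g z).

Definition ricci_form (R : realType) (n : nat)
    (g : 'rV[R[i]]_n -> 'M[R[i]]_n) (z : 'rV[R[i]]_n) :
    'rV[R[i]]_n -> 'rV[R[i]]_n -> R[i] :=
  form11 (- ddbar (fun w => clog (\det (g w))) z).

(* Einstein condition, on a domain D of C^n, for the metric with
   coefficients g. *)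
Definition kahler_einstein (R : realType) (n : nat) (D : set 'rV[R[i]]_n)
    (g : 'rV[R[i]]_n -> 'M[R[i]]_n) : Prop :=
  exists c : R, forall z : 'rV[R[i]]_n, D z ->
    forall u v : 'rV[R[i]]_n, ricci_form g z u v = c%:C * kahler_form g z u v.

Definition bidisc (R : realType) : set 'rV[R[i]]_2 :=
  [set z | forall i, `|z 0 i| < 1].
Arguments bidisc R : clear implicits.

(* The coordinates z_1, z_2 of the bidisc are z 0 0 and z 0 1. *)
Definition kerB (R : realType) (alpha beta gamma : R)
    (z w : 'rV[R[i]]_2) : R[i] :=
  cpow (1 - z 0 0 * (w 0 0)^*%C) (- alpha)
  * cpow (1 - z 0 1 * (w 0 1)^*%C) (- beta)
  * cpow (1 - z 0 0 * (w 0 1)^*%C) gamma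
  * cpow (1 - z 0 1 * (w 0 0)^*%C) gamma.

Definition metricB (R : realType) (alpha beta gamma : R)
    (z : 'rV[R[i]]_2) : 'M[R[i]]_2 :=
  ddbar (fun w => clog (kerB alpha beta gamma w w)) z.

(* Main.v *)
(* On the slice z_2 = 0, put s = 1 - |z_1|^2. There the metric has determinant
   alpha beta / s^2 - gamma^2, and the (1,1) component of the Einstein equation
   with constant c involves only derivatives along the slice; cleared of
   denominators it reads, for all s in ]0, 1],
     2 alpha beta (alpha beta - 3 gamma^2 s^2 + 2 gamma^2 s^3)
       + c alpha (alpha beta - gamma^2 s^2)^2 = 0.
   The coefficient of s^3 is 4 alpha beta gamma^2, which is not zero. *)
Require Import Defs.
From mathcomp Require Import all_boot all_order all_algebra.
From mathcomp Require Import complex.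
From mathcomp Require Import all_classical all_reals all_analysis.
From mathcomp Require Import ring lra.

Set Implicit Arguments.
Unset Strict Implicit.
Unset Printing Implicit Defensive.

Import Order.TTheory GRing.Theory Num.Theory.
Import numFieldNormedType.Exports.

Local Open Scope classical_set_scope.
Local Open Scope ring_scope.
Local Open Scope complex_scope.

(** * Derivatives at 0 of complex-valued curves of a real parameter *)

Section ComplexDerivative.
Context {R : realType}.
Implicit Types (h k : R -> R[i]) (d e : R[i]).

(** Taken in components because [real_dderiv] differentiates them separately; [is_derive] also
    records differentiability, which the product and chain rules require. *)
Definition cderive0 h d :=
  is_derive (0 : R) (1 : R) (fun t => complex.Re (h t)) (complex.Re d) /\
  is_derive (0 : R) (1 : R) (fun t => complex.Im (h t)) (complex.Im d).

Lemma cderive0_eq h d e : cderive0 h d -> d = e -> cderive0 h e.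
Proof. by move=> ? <-. Qed.

Lemma cderive0_cst c : cderive0 (fun=> c) 0.
Proof. by split; exact: is_derive_cst. Qed.

Lemma cderive0_line c d : cderive0 (fun t => c + t%:C * d) d.
Proof.
case: c d => [c1 c2] [d1 d2]; split => /=.
- have -> : (fun t : R => c1 + (t * d1 - 0 * d2)) = cst c1 + cst d1 * id.
    by apply/funext => t; rewrite !fctE; ring.
  by apply: is_derive_eq; rewrite /GRing.scale /=; ring.
- have -> : (fun t : R => c2 + (t * d2 + 0 * d1)) = cst c2 + cst d2 * id.
    by apply/funext => t; rewrite !fctE; ring.
  by apply: is_derive_eq; rewrite /GRing.scale /=; ring.
Qed.

Lemma cderive0D h k d e :
  cderive0 h d -> cderive0 k e -> cderive0 (fun t => h t + k t) (d + e).
Proof.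
move=> [h1 h2] [k1 k2]; split.
- have -> : (fun t => complex.Re (h t + k t)) =
    (fun t => complex.Re (h t)) + (fun t => complex.Re (k t)).
    by apply/funext => t; rewrite fctE; case: (h t) (k t) => [? ?] [].
  by apply: is_derive_eq; case: (d) (e) => [? ?] [].
- have -> : (fun t => complex.Im (h t + k t)) =
    (fun t => complex.Im (h t)) + (fun t => complex.Im (k t)).
    by apply/funext => t; rewrite fctE; case: (h t) (k t) => [? ?] [].
  by apply: is_derive_eq; case: (d) (e) => [? ?] [].
Qed.

Lemma cderive0M h k d e : cderive0 h d -> cderive0 k e ->
  cderive0 (fun t => h t * k t) (d * k 0 + h 0 * e).
Proof.
move=> [h1 h2] [k1 k2]; split.
- have -> : (fun t => complex.Re (h t * k t)) =
    (fun t => complex.Re (h t)) * (fun t => complex.Re (k t))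
    - (fun t => complex.Im (h t)) * (fun t => complex.Im (k t)).
    by apply/funext => t; rewrite !fctE; case: (h t) (k t) => [? ?] [].
  apply: is_derive_eq; rewrite /GRing.scale /=.
  by case: (d) (e) (h 0) (k 0) => [? ?] [? ?] [? ?] [? ?] /=; ring.
- have -> : (fun t => complex.Im (h t * k t)) =
    (fun t => complex.Re (h t)) * (fun t => complex.Im (k t))
    + (fun t => complex.Im (h t)) * (fun t => complex.Re (k t)).
    by apply/funext => t; rewrite !fctE; case: (h t) (k t) => [? ?] [].
  apply: is_derive_eq; rewrite /GRing.scale /=.
  by case: (d) (e) (h 0) (k 0) => [? ?] [? ?] [? ?] [? ?] /=; ring.
Qed.

Lemma cderive0_conj h d : cderive0 h d -> cderive0 (fun t => (h t)^*%C) d^*%C.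
Proof.
move=> [h1 h2]; split.
- have -> : (fun t => complex.Re (h t)^*%C) = (fun t => complex.Re (h t)).
    by apply/funext => t; case: (h t).
  by case: (d) h1.
- have -> : (fun t => complex.Im (h t)^*%C) = - (fun t => complex.Im (h t)).
    by apply/funext => t; rewrite fctE; case: (h t).
  by apply: is_derive_eq; case: (d).
Qed.

(** The inverse is the conjugate divided by the squared modulus [N], so real calculus applies to
    both components. *)
Lemma cderive0V h d : h 0 != 0 -> cderive0 h d ->
  cderive0 (fun t => (h t)^-1) (- (h 0) ^- 2 * d).
Proof.
move=> h0 [h1 h2].
pose re t := complex.Re (h t); pose im t := complex.Im (h t).
pose N := re * re + im * im.
have N0 : N 0 != 0.
  rewrite /N !fctE /re /im; apply: contra h0 => /eqP.
  case: (h 0) => x y /= N0; rewrite eq_complex /=.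
  have : x ^+ 2 + y ^+ 2 = 0 by rewrite -[RHS]N0 !expr2.
  by move/eqP; rewrite paddr_eq0 ?sqr_ge0// !sqrf_eq0.
have dN : is_derive (0 : R) (1 : R) N
    (2 * (re 0 * complex.Re d + im 0 * complex.Im d)).
  by apply: is_derive_eq; rewrite /GRing.scale /= /re /im; ring.
have dV := is_deriveV N0 dN.
have E : N 0 = complex.Re (h 0) ^+ 2 + complex.Im (h 0) ^+ 2 by [].
have F : (h 0)^-1 = (complex.Re (h 0) / N 0) -i* (complex.Im (h 0) / N 0).
  by rewrite E; case: (h 0).
rewrite -exprVn F; split.
- have -> : (fun t => complex.Re (h t)^-1) = re * (fun t => (N t)^-1).
    by apply/funext => t; rewrite /N /re /im !fctE; case: (h t).
  apply: is_derive_eq; rewrite /GRing.scale /=; move: N0; rewrite E /re /im.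
  by case: (d) (h 0) => [? ?] [? ?] /= N0; field.
- have -> : (fun t => complex.Im (h t)^-1) = - (im * (fun t => (N t)^-1)).
    by apply/funext => t; rewrite /N /re /im !fctE; case: (h t) => ? ? /=.
  apply: is_derive_eq; rewrite /GRing.scale /=; move: N0; rewrite E /re /im.
  by case: (d) (h 0) => [? ?] [? ?] /= N0; field.
Qed.

(** As [h] is real at every time, so is its derivative, and [d / h 0] is the real quotient given by
    the chain rule. *)
Lemma cderive0_ln h d : (forall t, complex.Im (h t) = 0) ->
  0 < complex.Re (h 0) -> cderive0 h d ->
  cderive0 (fun t => (ln (complex.Re (h t)))%:C) (d / h 0).
Proof.
move=> hR h0 [h1 h2].
have d0 : complex.Im d = 0.
  have e : (fun t => complex.Im (h t)) = cst 0 by apply/funext => t; rewrite hR.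
  have := h2; rewrite e => /@derive_val <-; exact: derive_cst.
have -> : h 0 = (complex.Re (h 0))%:C by rewrite [LHS]complexE hR mulr0 addr0.
have -> : d / (complex.Re (h 0))%:C = (complex.Re d / complex.Re (h 0))%:C.
  by rewrite {1}[d]complexE d0 mulr0 addr0 rmorphM fmorphV.
split => /=; last exact: is_derive_cst.
have := is_derive1_comp (is_derive1_ln h0) h1.
by rewrite mulrC.
Qed.

Lemma near_cderive0 h k d : (\forall t \near (0 : R), h t = k t) ->
  cderive0 h d -> cderive0 k d.
Proof.
move=> hk [h1 h2]; split.
- apply: near_eq_is_derive h1; near=> t.
  by congr complex.Re; near: t.
- apply: near_eq_is_derive h2; near=> t.
  by congr complex.Im; near: t.
Unshelve. all: by end_near. Qed.

End ComplexDerivative.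

(** * Calculus for the Wirtinger operators *)

Lemma conjc_i (R : realType) : ('i%C)^*%C = - 'i%C :> R[i].
Proof. by apply/eqP; rewrite eq_complex /= oppr0 !eqxx. Qed.

Section Wirtinger.
Context {R : realType} {n : nat}.
Implicit Types (f g : 'rV[R[i]]_n -> R[i]) (z w : 'rV[R[i]]_n) (i : 'I_n).

(* [a] and [b] are the derivatives of [f] at [z] with respect to [z_i] and its
   conjugate: the real derivative along [c e_i] is [a c + b c^*]. *)
Definition wirtinger i f z (a b : R[i]) := forall c : R[i],
  cderive0 (fun t => f (z + t%:C *: (c *: delta_mx 0 i))) (a * c + b * c^*%C).

Lemma wirtinger_line0 f z (v : 'rV[R[i]]_n) : f (z + (0 : R)%:C *: v) = f z.
Proof. by rewrite scale0r addr0. Qed.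

Lemma wirtinger_eq i f z a b a' b' : wirtinger i f z a b ->
  a = a' -> b = b' -> wirtinger i f z a' b'.
Proof. by move=> ? <- <-. Qed.

Lemma real_dderivE f z v d :
  cderive0 (fun t => f (z + t%:C *: v)) d -> real_dderiv f z v = d.
Proof.
case: d => d1 d2 [/= h1 h2]; rewrite /real_dderiv !derive1E.
by rewrite (@derive_val _ _ _ _ _ _ _ h1) (@derive_val _ _ _ _ _ _ _ h2).
Qed.

(** These are the cases [c = 1] and [c = 'i] of [wirtinger], the two directions from which [dz] and
    [dzbar] recover [a] and [b]. *)
Lemma wirtinger_real_dderiv i f z a b : wirtinger i f z a b ->
  real_dderiv f z (delta_mx 0 i) = a + b /\
  real_dderiv f z ('i%C *: delta_mx 0 i) = 'i%C * (a - b).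
Proof.
move=> fab; split; apply: real_dderivE.
- by have := fab 1; rewrite scale1r rmorph1 !mulr1.
- apply: cderive0_eq (fab 'i%C) _.
  by rewrite conjc_i; ring.
Qed.

Lemma dzE i f z a b : wirtinger i f z a b -> dz i f z = a.
Proof.
move=> /wirtinger_real_dderiv[e1 e2]; rewrite /dz e1 e2 mulrA -expr2 sqr_i.
by field.
Qed.

Lemma dzbarE i f z a b : wirtinger i f z a b -> dzbar i f z = b.
Proof.
move=> /wirtinger_real_dderiv[e1 e2]; rewrite /dzbar e1 e2 mulrA -expr2 sqr_i.
by field.
Qed.

Lemma wirtinger_cst i z c : wirtinger i (fun=> c) z 0 0.
Proof. by move=> d; rewrite !mul0r addr0; exact: cderive0_cst. Qed.

Lemma wirtinger_coord i j z : wirtinger i (fun w => w 0 j) z (i == j)%:R 0.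
Proof.
move=> c; rewrite mul0r addr0.
have -> : (fun t => (z + t%:C *: (c *: delta_mx 0 i)) 0 j) =
    (fun t : R => z 0 j + t%:C * ((i == j)%:R * c)).
  by apply/funext => t; rewrite !mxE eqxx /= eq_sym [_ * c]mulrC.
exact: cderive0_line.
Qed.

Lemma wirtingerD i f g z a b a' b' :
  wirtinger i f z a b -> wirtinger i g z a' b' ->
  wirtinger i (fun w => f w + g w) z (a + a') (b + b').
Proof.
by move=> hf hg c; rewrite 2!mulrDl addrACA; exact: cderive0D.
Qed.

Lemma wirtingerM i f g z a b a' b' :
  wirtinger i f z a b -> wirtinger i g z a' b' ->
  wirtinger i (fun w => f w * g w) z (a * g z + f z * a') (b * g z + f z * b').
Proof.
move=> hf hg c; apply: cderive0_eq (cderive0M (hf c) (hg c)) _.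
by rewrite !wirtinger_line0; ring.
Qed.

Lemma wirtingerN i f z a b : wirtinger i f z a b ->
  wirtinger i (fun w => - f w) z (- a) (- b).
Proof.
move=> /(wirtingerM (wirtinger_cst i z (-1)))/wirtinger_eq.
rewrite (_ : (fun w => -1 * f w) = (fun w => - f w)); last first.
  by apply/funext => w; rewrite mulN1r.
by apply; ring.
Qed.

Lemma wirtingerV i f z a b : f z != 0 -> wirtinger i f z a b ->
  wirtinger i (fun w => (f w)^-1) z (- a / f z ^+ 2) (- b / f z ^+ 2).
Proof.
move=> f0 hf c; have := @cderive0V _ _ _ _ (hf c).
rewrite !wirtinger_line0 => /(_ f0)/cderive0_eq; apply.
by rewrite -exprVn; ring.
Qed.

(** Conjugating [a c + b c^*] swaps the roles of [c] and its conjugate. *)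
Lemma wirtinger_conj i f z a b : wirtinger i f z a b ->
  wirtinger i (fun w => (f w)^*%C) z b^*%C a^*%C.
Proof.
move=> hf c; have := cderive0_conj (hf c).
by rewrite rmorphD !rmorphM/= conjcK addrC.
Qed.

Lemma wirtinger_ln i f z a b : (forall w, complex.Im (f w) = 0) ->
  0 < complex.Re (f z) -> wirtinger i f z a b ->
  wirtinger i (fun w => (ln (complex.Re (f w)))%:C) z (a / f z) (b / f z).
Proof.
move=> fR f0 hf c; have := cderive0_ln (fun t => fR _) _ (hf c).
by rewrite !wirtinger_line0 => /(_ f0)/cderive0_eq; apply; ring.
Qed.

Lemma near_wirtinger i f g z a b :
  (forall v, \forall t \near (0 : R), f (z + t%:C *: (v *: delta_mx 0 i)) =
                               g (z + t%:C *: (v *: delta_mx 0 i))) ->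
  wirtinger i f z a b -> wirtinger i g z a b.
Proof. by move=> fg hf c; apply: near_cderive0 (fg c) (hf c). Qed.

End Wirtinger.

(** * Locality of differentiation on the bidisc *)

Lemma bidisc_line (R : realType) (z v : 'rV[R[i]]_2) : bidisc R z ->
  \forall t \near (0 : R), bidisc R (z + t%:C *: v).
Proof.
move=> zD.
have near_coord (j : 'I_2) :
    \forall t \near (0 : R), `|(z + t%:C *: v) 0 j| < 1.
  have := zD j; rewrite normc_def ltcE /= eqxx /=; set r := Num.sqrt _ => r1.
  pose m := complex.Re `|v 0 j|.
  have vm : `|v 0 j| = m%:C by rewrite /m normc_def.
  have m0 : 0 <= m by rewrite -ler0c -vm.
  near=> t; rewrite !mxE (le_lt_trans (ler_normD _ _))//.
  rewrite normrM vm [`|z 0 j|]normc_def -/r.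
  have -> : `|t%:C| = `|t|%:C by rewrite normc_def /= expr0n addr0 sqrtr_sqr.
  rewrite -rmorphM -rmorphD -(rmorph1 (real_complex R)) ltcR.
  (* With [r = |z_j|] and [m = |v_j|], this bound gives [r + |t| m < 1]; the [+ 1] keeps the
     denominator positive when [m = 0]. *)
  have tm : `|t| < (1 - r) / (m + 1).
    near: t; apply: (@nbhs0_lt R R); rewrite divr_gt0 ?subr_gt0 ?ltr_pwDr//.
  have : `|t| * (m + 1) < 1 - r by rewrite -ltr_pdivlMr ?ltr_pwDr.
  by have := normr_ge0 t; nra.
near=> t; move=> j.
have [->|->] : j = 0 \/ j = 1.
  by case: j => [[|[|//]]] ?; [left|right]; exact/val_inj.
- by near: t; exact: near_coord.
- by near: t; exact: near_coord.
Unshelve. all: by end_near. Qed.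

(** Motion along [e_i] fixes the other coordinates and stays in the bidisc for small times. A
    formula known only on a slice can thus be differentiated along that slice. *)
Lemma bidisc_wirtinger (R : realType) (i : 'I_2) f g (z : 'rV[R[i]]_2) a b :
  bidisc R z ->
  (forall w, bidisc R w -> (forall j, j != i -> w 0 j = z 0 j) -> f w = g w) ->
  wirtinger i f z a b -> wirtinger i g z a b.
Proof.
move=> zD fg; apply: near_wirtinger => v; near=> t; apply: fg.
- by near: t; exact: bidisc_line.
- by move=> j /negPf ji; rewrite !mxE ji andbF !mulr0 addr0.
Unshelve. all: by end_near. Qed.

(** * Principal logarithms and powers in the right half-plane *)

Section PrincipalBranch.
Context {R : realType}.
Implicit Types (u : R[i]) (a x : R).

Lemma clog_real x : 0 < x -> clog x%:C = (ln x)%:C.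
Proof.
move=> x0; rewrite /clog /carg normc_def /= expr0n addr0 sqrtr_sqr gtr0_norm//.
by rewrite lexx divff ?gt_eqF// acos1.
Qed.

(** Conjugation switches the branch of the test in [carg], except for real [u], where positivity
    makes the argument [acos 1 = 0]. *)
Lemma carg_conj u : 0 < complex.Re u -> carg u^*%C = - carg u.
Proof.
move=> u0; rewrite /carg !normc_def /=; case: u u0 => x y /= x0.
rewrite sqrrN oppr_ge0; case: (ltgtP 0 y) => [_|_|<-]; rewrite ?opprK//.
by rewrite expr0n addr0 sqrtr_sqr gtr0_norm// divff ?gt_eqF// acos1 oppr0.
Qed.

(** The two powers have equal moduli and opposite phases, so the phases cancel and [|u|^(2a)]
    remains. *)
Lemma cpow_conj u a : 0 < complex.Re u ->
  cpow u a * cpow u^*%C a = (expR (a * ln (complex.Re (u * u^*%C))))%:C.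
Proof.
move=> u0; rewrite /cpow /cexp /clog carg_conj// !normc_def.
set r := Num.sqrt _.
have -> : Num.sqrt (complex.Re u^*%C ^+ 2 + complex.Im u^*%C ^+ 2) = r.
  by rewrite /r; case: (u) => x y /=; rewrite sqrrN.
have -> : complex.Re (u * u^*%C) = r ^+ 2.
  rewrite sqr_sqrtr ?addr_ge0 ?sqr_ge0//.
  by case: (u) => x y /=; rewrite mulrN opprK -!expr2.
have r0 : 0 < r.
  by rewrite sqrtr_gt0 ltr_pwDl ?exprn_gt0 ?sqr_ge0.
rewrite lnXn// /=; set l := ln r; set t := carg u.
have -> : a * (l *+ 2) = a * l + a * l by ring.
rewrite expRD.
have -> : a * - t + 0 * l = - (a * t + 0 * l) by ring.
rewrite sinN cosN !mul0r !subr0 addr0.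
have := cos2Dsin2 (a * t); set c := cos _; set s := sin _ => cs.
rewrite ?oppr0 ?expR0 ?mulr1 ?expRD.
apply/eqP; rewrite eq_complex /=; apply/andP; split; apply/eqP; last by ring.
by rewrite -[RHS]mulr1 -cs; ring.
Qed.

Lemma cpow_real x a : 0 < x -> cpow x%:C a = (expR (a * ln x))%:C.
Proof.
move=> x0; rewrite /cpow clog_real// /cexp /=.
by rewrite !(mulr0, mul0r, subr0, addr0) cos0 sin0 mulr1.
Qed.

(** The two real powers and the conjugate pair are exponentials of real numbers, so the logarithm of
    the product is the sum of the exponents, with no branch correction. *)
Lemma clog_cpow_prod x y u a b c : 0 < x -> 0 < y -> 0 < complex.Re u ->
  clog (cpow x%:C a * cpow y%:C b * cpow u c * cpow u^*%C c) =
  (a * ln x + b * ln y + c * ln (complex.Re (u * u^*%C)))%:C.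
Proof.
move=> x0 y0 u0; rewrite -[X in clog X]mulrA cpow_conj// !cpow_real//.
by rewrite -2!(rmorphM (real_complex R)) -2!expRD clog_real ?expR_gt0// expRK.
Qed.

End PrincipalBranch.

(** * The kernel on the diagonal *)

Section Kernel.
Context {R : realType}.
Implicit Types (z w : 'rV[R[i]]_2) (alpha beta gamma : R).

(** The point lies in the open unit disc around 1, since the product subtracted has modulus less
    than 1. *)
Lemma bidisc_Re_gt0 z i j : bidisc R z ->
  0 < complex.Re (1 - z 0 i * (z 0 j)^*%C).
Proof.
move=> zD; have := zD i; have := zD j => zj zi.
have : `|z 0 i * (z 0 j)^*%C| < 1.
  by rewrite normrM normcJ mulr_ilt1.
move=> /(le_lt_trans (normc_ge_Re _)); rewrite -(rmorph1 (real_complex R)) ltcR.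
by rewrite ltr_norml; case: (z 0 i * _) => x y /= /andP[_]; rewrite subr_gt0.
Qed.

Lemma bidisc_neq0 z i j : bidisc R z -> 1 - z 0 i * (z 0 j)^*%C != 0.
Proof.
move=> /(bidisc_Re_gt0 i j); apply: contraTneq => ->; by rewrite ltxx.
Qed.

Lemma Im_self z i : complex.Im (1 - z 0 i * (z 0 i)^*%C) = 0.
Proof. by case: (z 0 i) => x y /=; ring. Qed.

Lemma Im_cross z i j :
  complex.Im ((1 - z 0 i * (z 0 j)^*%C) * (1 - z 0 j * (z 0 i)^*%C)) = 0.
Proof. by case: (z 0 i) (z 0 j) => [? ?] [? ?] /=; ring. Qed.

(** On the diagonal the two cross factors are conjugate, so [clog_cpow_prod] applies. Only real
    logarithms remain, in the form that [wirtinger_ln] differentiates. *)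
Lemma clog_kerB alpha beta gamma z : bidisc R z ->
  clog (kerB alpha beta gamma z z) =
  (- alpha)%:C * (ln (complex.Re (1 - z 0 0 * (z 0 0)^*%C)))%:C
  + (- beta)%:C * (ln (complex.Re (1 - z 0 1 * (z 0 1)^*%C)))%:C
  + gamma%:C * (ln (complex.Re ((1 - z 0 0 * (z 0 1)^*%C)
                              * (1 - z 0 1 * (z 0 0)^*%C))))%:C.
Proof.
move=> zD.
have self i : (complex.Re (1 - z 0 i * (z 0 i)^*%C))%:C =
    1 - z 0 i * (z 0 i)^*%C.
  by rewrite [RHS]complexE Im_self mulr0 addr0.
have conj1 : (1 - z 0 0 * (z 0 1)^*%C)^*%C = 1 - z 0 1 * (z 0 0)^*%C.
  by rewrite rmorphB rmorphM rmorph1/= conjcK mulrC.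
have := @clog_cpow_prod _ _ _ _ (- alpha) (- beta) gamma
  (bidisc_Re_gt0 0 0 zD) (bidisc_Re_gt0 1 1 zD) (bidisc_Re_gt0 0 1 zD).
rewrite (self 0) (self 1) conj1 => ->; rewrite !(rmorphD (real_complex R)) /=.
by rewrite !(rmorphM (real_complex R)).
Qed.

End Kernel.

(** * The coefficients of the metric *)

Section Metric.
Context {R : realType}.
Implicit Types (z w : 'rV[R[i]]_2) (i j k : 'I_2).

Lemma wirtinger_pair i j k z :
  wirtinger i (fun w => 1 - w 0 j * (w 0 k)^*%C) z
    (- ((i == j)%:R * (z 0 k)^*%C)) (- (z 0 j * (i == k)%:R)).
Proof.
have := wirtingerD (wirtinger_cst i z 1) (wirtingerN
  (wirtingerM (wirtinger_coord i j z)
     (wirtinger_conj (wirtinger_coord i k z)))).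
move/wirtinger_eq; apply.
- by rewrite rmorph0 mulr0 addr0 add0r.
- by rewrite rmorph_nat mul0r !add0r.
Qed.

(** The [dzbar] derivatives of the logarithm of the kernel are combinations of these quotients,
    whose [dz] derivatives then give the metric. *)
Lemma wirtinger_quot i j k z : bidisc R z ->
  wirtinger i (fun w => w 0 j / (1 - w 0 j * (w 0 k)^*%C)) z
    ((i == j)%:R / (1 - z 0 j * (z 0 k)^*%C) ^+ 2)
    ((i == k)%:R * z 0 j ^+ 2 / (1 - z 0 j * (z 0 k)^*%C) ^+ 2).
Proof.
move=> /(bidisc_neq0 j k) u0.
have := wirtingerM (wirtinger_coord i j z)
  (wirtingerV (f := fun w => 1 - w 0 j * (w 0 k)^*%C) u0
     (wirtinger_pair i j k z)).
move/wirtinger_eq; apply; move: u0; move: (z 0 j) (z 0 k)^*%C => a b u0.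
- by field.
- by field.
Qed.

Variables (alpha beta gamma : R).

(** The factors are conjugate, so the product is the squared modulus of a nonzero number. *)
Lemma Re_cross_gt0 z i j : bidisc R z ->
  0 < complex.Re ((1 - z 0 i * (z 0 j)^*%C) * (1 - z 0 j * (z 0 i)^*%C)).
Proof.
move=> /(bidisc_Re_gt0 i j).
have -> : 1 - z 0 j * (z 0 i)^*%C = (1 - z 0 i * (z 0 j)^*%C)^*%C.
  by rewrite rmorphB rmorphM rmorph1/= conjcK mulrC.
case: (1 - _) => x y /= x0.
by rewrite mulrN opprK ltr_pwDl ?mulr_gt0// -expr2 sqr_ge0.
Qed.

Lemma dzbar_clog_kerB i z : bidisc R z ->
  dzbar i (fun w => clog (kerB alpha beta gamma w w)) z =
  alpha%:C * (i == 0)%:R * (z 0 0 / (1 - z 0 0 * (z 0 0)^*%C))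
  + beta%:C * (i == 1)%:R * (z 0 1 / (1 - z 0 1 * (z 0 1)^*%C))
  - gamma%:C * (i == 1)%:R * (z 0 0 / (1 - z 0 0 * (z 0 1)^*%C))
  - gamma%:C * (i == 0)%:R * (z 0 1 / (1 - z 0 1 * (z 0 0)^*%C)).
Proof.
move=> zD.
have d00 := wirtinger_ln (fun w => Im_self w 0) (bidisc_Re_gt0 0 0 zD)
  (wirtinger_pair i 0 0 z).
have d11 := wirtinger_ln (fun w => Im_self w 1) (bidisc_Re_gt0 1 1 zD)
  (wirtinger_pair i 1 1 z).
have d01 := wirtinger_ln (fun w => Im_cross w 0 1) (Re_cross_gt0 0 1 zD)
  (wirtingerM (wirtinger_pair i 0 1 z) (wirtinger_pair i 1 0 z)).
have := wirtingerD (wirtingerD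
  (wirtingerM (wirtinger_cst i z (- alpha)%:C) d00)
  (wirtingerM (wirtinger_cst i z (- beta)%:C) d11))
  (wirtingerM (wirtinger_cst i z gamma%:C) d01).
move=> /(bidisc_wirtinger (g := fun w => clog (kerB alpha beta gamma w w)) zD).
move=> /(_ (fun w wD _ => esym (clog_kerB alpha beta gamma wD)))/dzbarE ->.
move: (bidisc_neq0 0 0 zD) (bidisc_neq0 1 1 zD) (bidisc_neq0 0 1 zD)
  (bidisc_neq0 1 0 zD).
rewrite !rmorphN /=.
(* The product rule with a constant factor leaves zero times each logarithm. With logarithms and
   conjugates turned into free variables, the claim is a rational identity. *)
move: (ln _)%:C (ln _)%:C (ln _)%:C => l1 l2 l3.
move: (z 0 0) (z 0 1) => a b; move: a^*%C b^*%C => a' b' n1 n2 n3 n4.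
by field; rewrite n1 n2 n3 n4.
Qed.

(** [dzbar_clog_kerB] holds on the whole bidisc, hence near [z], and can be differentiated term by
    term. *)
Lemma metricBE z i j : bidisc R z ->
  metricB alpha beta gamma z i j =
  alpha%:C * (j == 0)%:R * ((i == 0)%:R / (1 - z 0 0 * (z 0 0)^*%C) ^+ 2)
  + beta%:C * (j == 1)%:R * ((i == 1)%:R / (1 - z 0 1 * (z 0 1)^*%C) ^+ 2)
  - gamma%:C * (j == 1)%:R * ((i == 0)%:R / (1 - z 0 0 * (z 0 1)^*%C) ^+ 2)
  - gamma%:C * (j == 0)%:R * ((i == 1)%:R / (1 - z 0 1 * (z 0 0)^*%C) ^+ 2).
Proof.
move=> zD; rewrite mxE.
have := wirtingerD (wirtingerD (wirtingerD
  (wirtingerM (wirtinger_cst i z (alpha%:C * (j == 0)%:R))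
     (wirtinger_quot i 0 0 zD))
  (wirtingerM (wirtinger_cst i z (beta%:C * (j == 1)%:R))
     (wirtinger_quot i 1 1 zD)))
  (wirtingerN (wirtingerM (wirtinger_cst i z (gamma%:C * (j == 1)%:R))
     (wirtinger_quot i 0 1 zD))))
  (wirtingerN (wirtingerM (wirtinger_cst i z (gamma%:C * (j == 0)%:R))
     (wirtinger_quot i 1 0 zD))).
move=> /(bidisc_wirtinger zD).
move=> /(_ _ (fun w wD _ => esym (dzbar_clog_kerB j wD)))/dzE ->.
by rewrite !mul0r !add0r.
Qed.

End Metric.

(** * The determinant and the Ricci coefficient on the slice *)

Lemma det_mx2 (R : comPzRingType) (A : 'M[R]_2) :
  \det A = A 0 0 * A 1 1 - A 0 1 * A 1 0.
Proof.
rewrite (expand_det_row _ 0) !big_ord_recl big_ord0 addr0 /cofactor !det_mx11.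
rewrite !mxE /= expr0 mul1r expr1 mulN1r mulrN.
by congr (A _ _ * A _ _ - A _ _ * A _ _); exact/val_inj.
Qed.

Section Slice.
Context {R : realType} (alpha beta gamma : R).
Hypothesis gamma2_lt : gamma ^+ 2 < alpha * beta.
Implicit Types (z w : 'rV[R[i]]_2).

(* On the slice [w 0 1 = 0], [slice_det w] is the determinant of the metric and
   [slice_num w] its numerator over the common denominator [rho w ^+ 2]. *)
Local Notation rho w := (1 - w 0 0 * (w 0 0)^*%C).
Local Notation slice_num w :=
  ((alpha * beta)%:C - (gamma ^+ 2)%:C * (rho w * rho w)).
Local Notation slice_det w :=
  ((alpha * beta)%:C * ((rho w)^-1 * (rho w)^-1) - (gamma ^+ 2)%:C).

Lemma rho_real w : rho w = (complex.Re (rho w))%:C.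
Proof. by rewrite [LHS]complexE Im_self mulr0 addr0. Qed.

Lemma slice_det_real w : slice_det w =
  (alpha * beta * ((complex.Re (rho w))^-1 * (complex.Re (rho w))^-1)
   - gamma ^+ 2)%:C.
Proof.
rewrite rho_real; move: (complex.Re (rho w)) (alpha * beta) => s ab /=.
by rewrite rmorphB !rmorphM fmorphV.
Qed.

Lemma Re_rho_le1 w : complex.Re (rho w) <= 1.
Proof.
case: (w 0 0) => x y /=; rewrite mulrN opprK -!expr2 gerBl.
by rewrite addr_ge0 ?sqr_ge0.
Qed.

(** Since [0 < s <= 1] for [s = rho w], the first term is at least [alpha * beta], which exceeds
    [gamma ^+ 2]. *)
Lemma slice_det_gt0 w : bidisc R w -> 0 < complex.Re (slice_det w).
Proof.
move=> /(bidisc_Re_gt0 0 0) u0; rewrite slice_det_real /=.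
have := Re_rho_le1 w; move: (complex.Re _) u0 => s s0 s1.
have : 1 <= s^-1 * s^-1 by rewrite mulr_ege1// invf_ge1.
move: (_ * s^-1) => X X1; rewrite subr_gt0 (lt_le_trans gamma2_lt)//.
by rewrite ler_peMr// (le_trans _ (ltW gamma2_lt))// sqr_ge0.
Qed.

Lemma Im_slice_det w : complex.Im (slice_det w) = 0.
Proof. by rewrite slice_det_real. Qed.

Lemma slice_num_neq0 w : bidisc R w -> slice_num w != 0.
Proof.
move=> wD; have /(bidisc_Re_gt0 0 0) u0 := wD.
have -> : slice_num w =
    (alpha * beta - gamma ^+ 2 * complex.Re (rho w) ^+ 2)%:C.
  rewrite rho_real; move: (complex.Re (rho w)) (alpha * beta) => s ab /=.
  by rewrite rmorphB !rmorphM.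
rewrite -(rmorph0 (real_complex R)) (inj_eq (@complexI _)) gt_eqF//.
have := Re_rho_le1 w; move: (complex.Re _) u0 => s s0 s1.
have : s ^+ 2 <= 1 by rewrite exprn_ile1// ltW.
move=> s2; rewrite subr_gt0 (le_lt_trans _ gamma2_lt)//.
by rewrite ler_piMr// sqr_ge0.
Qed.

(** On the slice the diagonal entries are [alpha / rho^2] and [beta], and both off-diagonal entries
    are [- gamma]. *)
Lemma clog_det_metricB w : bidisc R w -> w 0 1 = 0 ->
  clog (\det (metricB alpha beta gamma w)) = (ln (complex.Re (slice_det w)))%:C.
Proof.
move=> wD w1; rewrite det_mx2 !metricBE// w1 conjc0 /=.
rewrite (_ : _ - _ = slice_det w).
  by have := slice_det_gt0 wD; rewrite slice_det_real /=; exact: clog_real.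
have := bidisc_neq0 0 0 wD; move: (w 0 0) => a; move: a^*%C => a' n0.
have -> : (gamma ^+ 2)%:C = gamma%:C ^+ 2 by rewrite rmorphXn.
by rewrite rmorphM /=; field.
Qed.

(** The result is split into a quotient that [wirtinger_quot] handles and the inverse of
    [slice_num], ready for the second derivative. *)
Lemma dzbar_clog_det w : bidisc R w -> w 0 1 = 0 ->
  dzbar 0 (fun w => clog (\det (metricB alpha beta gamma w))) w =
  (2 * alpha * beta)%:C * (w 0 0 / rho w * (slice_num w)^-1).
Proof.
move=> wD w1.
have u0 := bidisc_neq0 0 0 wD.
have dV := wirtingerV (f := fun v => rho v) u0 (wirtinger_pair 0 0 0 w).
have := wirtinger_ln Im_slice_det (slice_det_gt0 wD)
  (wirtingerD (wirtingerM (wirtinger_cst 0 w (alpha * beta)%:C)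
     (wirtingerM dV dV)) (wirtinger_cst 0 w (- (gamma ^+ 2)%:C))).
move=> /(bidisc_wirtinger
  (g := fun w => clog (\det (metricB alpha beta gamma w))) wD) h.
(* Only the first coordinate varies, so [v] shares its second coordinate with [w] and stays on the
   slice. *)
have {h}/dzbarE -> := h (fun v vD v1 => esym (clog_det_metricB vD
  (etrans (v1 1 isT) w1))).
have := slice_num_neq0 wD; move: u0.
rewrite -!mulrA ![(2 * _)%:C]rmorphM /= rmorph_nat.
move: (w 0 0) (_ ^+ 2)%:C (alpha * beta)%:C => a; move: a^*%C => a' g ab u0 E0.
by field; rewrite u0 E0.
Qed.

(** Differentiating [slice_num] produces a factor [rho z], which cancels the denominator of
    [z 0 0 / rho z] in the second term. *)
Lemma ddbar_clog_det z : bidisc R z -> z 0 1 = 0 ->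
  ddbar (fun w => clog (\det (metricB alpha beta gamma w))) z 0 0 =
  (2 * alpha * beta)%:C * ((rho z * rho z * slice_num z)^-1
     - (2 * gamma ^+ 2)%:C * (z 0 0 * (z 0 0)^*%C)
       / (slice_num z * slice_num z)).
Proof.
move=> zD z1; rewrite mxE.
have E0 := slice_num_neq0 zD.
have du := wirtinger_pair 0 0 0 z.
have dE := wirtingerD (wirtinger_cst 0 z (alpha * beta)%:C)
  (wirtingerN (wirtingerM (wirtinger_cst 0 z (gamma ^+ 2)%:C)
    (wirtingerM du du))).
have := wirtingerM (wirtinger_cst 0 z (2 * alpha * beta)%:C)
  (wirtingerM (wirtinger_quot 0 0 0 zD)
     (wirtingerV (f := fun v => slice_num v) E0 dE)).
move=> /(bidisc_wirtinger
  (g := dzbar 0 (fun w => clog (\det (metricB alpha beta gamma w)))) zD) h.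
have {h}/dzE -> := h (fun v vD v1 => esym (dzbar_clog_det vD
  (etrans (v1 1 isT) z1))).
have := bidisc_neq0 0 0 zD; move: E0.
rewrite [(2 * gamma ^+ 2)%:C]rmorphM /= rmorph_nat.
move: (z 0 0) (gamma ^+ 2)%:C (alpha * beta)%:C (2 * alpha * beta)%:C => a.
move: a^*%C => a' g ab c E0 u0.
by field; rewrite u0 E0.
Qed.

End Slice.

(** * The Einstein equation along the slice *)

(** On the pair [e_1], [i e_1] the form [dz_1 /\ dzbar_1] takes the value [-2i] and the other
    [dz_i /\ dzbar_j] vanish. *)
Lemma form11_coef00 (R : realType) (h : 'M[R[i]]_2) :
  form11 h (delta_mx 0 0) ('i%C *: delta_mx 0 0) = 2 * h 0 0.
Proof.
rewrite /form11 (bigD1 0)//= (bigD1 0)//= !big1 => [|k k0|j j0]; last first.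
- by rewrite !mxE (negPf j0) !andbF !mulr0 !conjc0 !mulr0 subrr mulr0.
- rewrite big1// => j _.
  by rewrite !mxE (negPf k0) !andbF !mulr0 !mul0r subrr mulr0.
rewrite !mxE !eqxx !mulr1 !mul1r !addr0 conjc1 mulr1.
rewrite conjc_i.
have := sqr_i R; move: 'i%C (h 0 0) => I a I2.
have -> : I * (a * (- I - I)) = - (2 * a) * I ^+ 2 by ring.
by rewrite I2; ring.
Qed.

Lemma einstein_coef00 (R : realType) (g : 'rV[R[i]]_2 -> 'M[R[i]]_2) (c : R) z :
  (forall u v, ricci_form g z u v = c%:C * kahler_form g z u v) ->
  - ddbar (fun w => clog (\det (g w))) z 0 0 = c%:C * g z 0 0.
Proof.
move=> /(_ (delta_mx 0 0) ('i%C *: delta_mx 0 0)).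
rewrite /ricci_form /kahler_form !form11_coef00 [in LHS]mxE mulrCA.
by apply: mulfI; rewrite pnatr_eq0.
Qed.

Theorem corollary4p8 (R : realType) (alpha beta gamma : R)
    (alpha_gt0 : 0 < alpha) (beta_gt0 : 0 < beta) (gamma_gt0 : 0 < gamma)
    (gamma_lt_alpha : gamma < alpha) (gamma_lt_beta : gamma < beta) :
  ~ kahler_einstein (bidisc R) (metricB alpha beta gamma).
Proof.
move=> [c einstein].
have gamma2_lt : gamma ^+ 2 < alpha * beta by rewrite expr2 ltr_pM// ltW.
have key x : -1 < x < 1 -> let s := 1 - x ^+ 2 in
  2 * (alpha * beta) * (alpha * beta - 3 * gamma ^+ 2 * s ^+ 2
    + 2 * gamma ^+ 2 * s ^+ 3)
  + c * alpha * (alpha * beta - gamma ^+ 2 * s ^+ 2) ^+ 2 = 0.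
  move=> x1 s.
  (* A real point of the slice, where [rho z] is [s]. *)
  pose z : 'rV[R[i]]_2 := \row_j (if j == 0 then x%:C else 0).
  have zD : bidisc R z.
    move=> j; rewrite mxE; case: ifP => _; last by rewrite normr0.
    by rewrite normc_def /= expr0n addr0 sqrtr_sqr ltcR ltr_norml.
  have z1 : z 0 1 = 0 by rewrite mxE.
  have ric := ddbar_clog_det gamma2_lt zD z1.
  have met := metricBE alpha beta gamma 0 0 zD.
  have := etrans (congr1 -%R (esym ric))
    (etrans (einstein_coef00 (einstein z zD))
    (congr1 ( *%R c%:C) met)).
  have E0 := slice_num_neq0 gamma2_lt zD.
  have u0 := bidisc_neq0 0 0 zD.
  have u1 : 1 - z 0 0 * (z 0 0)^*%C = s%:C.
    by rewrite mxE eqxx conjc_real /s rmorphB rmorph1 rmorphXn expr2.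
  have zz : z 0 0 * (z 0 0)^*%C = (1 - s)%:C.
    by rewrite rmorphB rmorph1 /= -u1 subKr.
  move: E0 u0; rewrite u1 zz z1 conjc0 !eqxx !mulr0 !mul0r !subr0 => E0 u0 e.
  apply: (@complexI R).
  move/eqP: e; rewrite eq_sym -subr_eq0 => /eqP e.
  (* With [E = alpha beta - gamma^2 s^2], the denominators are [s^2 E], [E^2] and [s^2]; all divide
     [m^2 = s^2 E^2]. *)
  pose m := s * (alpha * beta - gamma ^+ 2 * (s * s)).
  rewrite rmorph0 -[RHS](mul0r (m ^+ 2)%:C) -{}e /m.
  move: E0; rewrite rmorphM rmorphXn /= => E0.
  by field; rewrite u0 E0.
have pq : 0 < alpha * beta * gamma ^+ 2 by rewrite !mulr_gt0 ?exprn_gt0.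
(* These give [s = 1, 3/4, 8/9, 15/16]. The identity combines only [1, s^2, s^3, s^4], so four
   distinct positive values force all four coefficients to vanish, against [4 p q > 0] at [s^3].
   With the monomials in [p], [q], [k] as unknowns, this is linear arithmetic. *)
have := key 0; have := key 2^-1; have := key 3^-1; have := key 4^-1.
rewrite /= => k4 k3 k2 k0.
have {}k4 := k4 ltac:(lra); have {}k3 := k3 ltac:(lra).
have {}k2 := k2 ltac:(lra); have {}k0 := k0 ltac:(lra).
move: pq k4 k3 k2 k0.
by move: (alpha * beta) (gamma ^+ 2) (c * alpha) => p q k; lra.
Qed.
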